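(* Let $H$ and $K$ be subgroups of finite index in the group $G=\langle X\mid R\rangle$, where $X$ is finite and $R$ is not necessarily finite. Then $H$ is conjugate to $K$ in $G$ if and only if the subgroup graphs $\Gamma_{X,R}(H)$ and $\Gamma_{X,R}(K)$ are isomorphic as (non-based) $X$-graphs.
   Context: An $X$-graph is a directed graph (loops and multiple edges allowed) in which every directed edge carries a label from $X$. A morphism of $X$-graphs maps vertices to vertices and directed edges to directed edges, preserving labels, origins and termini; an isomorphism is an invertible morphism. For a finite index subgroup $H$ of $G=\langle X\mid R\rangle$, the subgroup graph $\Gamma_{X,R}(H)$ is the Schreier coset graph of $H$ with respect to $X$ and $G$: its vertices are the right cosets $Hg$ ($g\in G$), and for each coset $Hg$ and each $x\in X$ there is one directed edge labeled $x$ with origin $Hg$ and terminus $Hgx$. Its base-vertex $1_H$ is the coset $H$. *)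

(* Defs.v *)
From HB Require Import structures.
From mathcomp Require Import all_boot.
From mathcomp Require Import boolp classical_sets cardinality.

Set Implicit Arguments.
Unset Strict Implicit.
Unset Printing Implicit Defensive.

Local Open Scope classical_set_scope.
Local Open Scope quotient_scope.
Local Open Scope group_scope.

(* Words over X and its formal inverses: (x, false) stands for x and          *)
(* (x, true) for x^-1.                                                        *)
Definition word (X : Type) := seq (X * bool).

Definition word_inv (X : Type) (w : word X) : word X :=
  rev [seq (a.1, ~~ a.2) | a <- w].

(* The smallest congruence making the letters x and x^-1 mutually inverse and *)
(* every relator trivial; its quotient is the free group on X modulo the      *)
(* normal closure of R.                                                       *)
Inductive word_cong (X : Type) (R : set (word X)) : word X -> word X -> Prop :=
| word_cong_refl u : word_cong R u u
| word_cong_sym u v : word_cong R u v -> word_cong R v u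
| word_cong_trans u v w :
    word_cong R u v -> word_cong R v w -> word_cong R u w
| word_cong_cat u1 u2 v1 v2 :
    word_cong R u1 v1 -> word_cong R u2 v2 ->
    word_cong R (u1 ++ u2) (v1 ++ v2)
| word_cong_cancel x b : word_cong R [:: (x, b); (x, ~~ b)] [::]
| word_cong_relator r : R r -> word_cong R r [::].

Section WordCong.
Variables (X : Type) (R : set (word X)).

Lemma word_cong_mulV (u : word X) : word_cong R (word_inv u ++ u) [::].
Proof.
elim: u => [|[x b] w IHw]; first exact: word_cong_refl.
rewrite /word_inv /= rev_cons cat_rcons.
apply: word_cong_trans IHw; apply: word_cong_cat; first exact: word_cong_refl.
apply: (@word_cong_cat _ _ [:: (x, ~~ b); (x, b)] w [::] w).
  by have := word_cong_cancel R x (~~ b); rewrite negbK.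
exact: word_cong_refl.
Qed.

Lemma word_cong_Vmul (u : word X) : word_cong R (u ++ word_inv u) [::].
Proof.
have {1}<- : word_inv (word_inv u) = u; last exact: word_cong_mulV.
rewrite /word_inv map_rev revK -map_comp -[RHS]map_id.
by apply: eq_map => -[x b] /=; rewrite negbK.
Qed.

Lemma word_cong_inv (u v : word X) :
  word_cong R u v -> word_cong R (word_inv u) (word_inv v).
Proof.
move=> uv; apply: (@word_cong_trans _ _ _ (word_inv u ++ (v ++ word_inv v))).
  rewrite -[X in word_cong R X]cats0; apply: word_cong_cat.
    exact: word_cong_refl.
  exact/word_cong_sym/word_cong_Vmul.
rewrite catA -[X in word_cong R _ X]cat0s; apply: word_cong_cat.
  apply: word_cong_trans (word_cong_mulV u); apply: word_cong_cat.
    exact: word_cong_refl.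
  exact: word_cong_sym.
exact: word_cong_refl.
Qed.

End WordCong.

Section PresentedGroup.
Variables (X : choiceType) (R : set (word X)).

Definition word_congb (u v : word X) : bool := `[< word_cong R u v >].

Lemma word_congb_refl : reflexive word_congb.
Proof. by move=> u; apply/asboolP; exact: word_cong_refl. Qed.

Lemma word_congb_sym : symmetric word_congb.
Proof. by move=> u v; apply/asboolP/asboolP; exact: word_cong_sym. Qed.

Lemma word_congb_trans : transitive word_congb.
Proof.
by move=> v u w /asboolP uv /asboolP vw; apply/asboolP/(word_cong_trans uv vw).
Qed.

Canonical word_cong_equiv :=
  EquivRel word_congb word_congb_refl word_congb_sym word_congb_trans.

Definition presented_group := {eq_quot word_cong_equiv}.

HB.instance Definition _ := Choice.on presented_group.
HB.instance Definition _ := EqQuotient.on presented_group.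

Definition word_class (w : word X) : presented_group := \pi w.

Lemma word_classP u v : word_class u = word_class v <-> word_cong R u v.
Proof.
split=> [/eqP | uv]; first by rewrite /word_class eqmodE => /asboolP.
by apply/eqP; rewrite /word_class eqmodE; apply/asboolP.
Qed.

Lemma word_class_repr (g : presented_group) : word_class (repr g) = g.
Proof. exact: reprK. Qed.

Lemma repr_word_class w : word_cong R (repr (word_class w)) w.
Proof. by apply/word_classP; rewrite word_class_repr. Qed.

Let pg_one : presented_group := word_class [::].
Let pg_inv (g : presented_group) : presented_group :=
  word_class (word_inv (repr g)).
Let pg_mul (g h : presented_group) : presented_group :=
  word_class (repr g ++ repr h).

Let pg_mulE u v : pg_mul (word_class u) (word_class v) = word_class (u ++ v).
Proof. by apply/word_classP/word_cong_cat; exact: repr_word_class. Qed.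

Let pg_invE u : pg_inv (word_class u) = word_class (word_inv u).
Proof. by apply/word_classP/word_cong_inv; exact: repr_word_class. Qed.

Let pg_mulA : associative pg_mul.
Proof.
move=> g h k; rewrite -[g]word_class_repr -[h]word_class_repr.
by rewrite -[k]word_class_repr !pg_mulE catA.
Qed.

Let pg_mul1 : left_id pg_one pg_mul.
Proof. by move=> g; rewrite -[g]word_class_repr pg_mulE. Qed.

Let pg_mulr1 : right_id pg_one pg_mul.
Proof. by move=> g; rewrite -[g]word_class_repr pg_mulE cats0. Qed.

Let pg_mulV : left_inverse pg_one pg_inv pg_mul.
Proof.
move=> g; rewrite -[g]word_class_repr pg_invE pg_mulE.
exact/word_classP/word_cong_mulV.
Qed.

Let pg_mulrV : right_inverse pg_one pg_inv pg_mul.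
Proof.
move=> g; rewrite -[g]word_class_repr pg_invE pg_mulE.
exact/word_classP/word_cong_Vmul.
Qed.

HB.instance Definition _ := isGroup.Build presented_group
  pg_mulA pg_mul1 pg_mulr1 pg_mulV pg_mulrV.

Lemma word_class1 : word_class [::] = 1.
Proof. by []. Qed.

Lemma word_classM u v : word_class (u ++ v) = word_class u * word_class v.
Proof. by rewrite -pg_mulE. Qed.

Lemma word_classV u : word_class (word_inv u) = (word_class u)^-1.
Proof. by rewrite -pg_invE. Qed.

Definition generator (x : X) : presented_group := word_class [:: (x, false)].

End PresentedGroup.

Section Subgroups.
Variable G : groupType.
Implicit Types H K : set G.

Definition is_subgroup H : Prop := group_closed (mem H).

Definition right_coset H (g : G) : set G := [set h * g | h in H].

Definition right_cosets H : set (set G) := range (right_coset H).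

Definition finite_index H : Prop := finite_set (right_cosets H).

Definition conjugate_subgroups H K : Prop :=
  exists g : G, K = [set h ^ g | h in H].

Lemma right_cosetM H g y :
  right_coset (right_coset H g) y = right_coset H (g * y).
Proof.
by rewrite /right_coset image_comp; apply: eq_imagel => h _ /=; rewrite mulgA.
Qed.

Lemma right_cosetsM H (A : set G) y :
  right_cosets H A -> right_cosets H (right_coset A y).
Proof. by case=> g _ <-; exists (g * y); rewrite ?right_cosetM. Qed.

End Subgroups.

Record xgraph (X : Type) : Type := XGraph {
  vertex : Type;
  edge : Type;
  edge_label : edge -> X;
  origin : edge -> vertex;
  terminus : edge -> vertex
}.

Record xgraph_morphism (X : Type) (A B : xgraph X) : Type := XGraphMorphism {
  on_vertices : vertex A -> vertex B;
  on_edges : edge A -> edge B;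
  morphism_label e : edge_label (on_edges e) = edge_label e;
  morphism_origin e : origin (on_edges e) = on_vertices (origin e);
  morphism_terminus e : terminus (on_edges e) = on_vertices (terminus e)
}.

Definition xgraph_inverse (X : Type) (A B : xgraph X)
    (f : xgraph_morphism A B) (f' : xgraph_morphism B A) : Prop :=
  [/\ cancel (on_vertices f) (on_vertices f'),
      cancel (on_vertices f') (on_vertices f),
      cancel (on_edges f) (on_edges f') &
      cancel (on_edges f') (on_edges f)].

Definition xgraph_isomorphic (X : Type) (A B : xgraph X) : Prop :=
  exists (f : xgraph_morphism A B) (f' : xgraph_morphism B A),
    xgraph_inverse f f'.

Section SubgroupGraph.
Variables (X : choiceType) (R : set (word X)) (H : set (presented_group R)).

Definition coset_vertex : Type := {A : set (presented_group R) | right_cosets H A}.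

(* If A = Hg then right_coset A x = Hgx (right_cosetM). *)
Definition coset_step (v : coset_vertex) (x : X) : coset_vertex :=
  exist _ (right_coset (sval v) (generator R x))
    (right_cosetsM (generator R x) (svalP v)).

Definition subgroup_graph : xgraph X := {|
  vertex := coset_vertex;
  edge := (coset_vertex * X)%type;
  edge_label := snd;
  origin := fst;
  terminus := fun e => coset_step e.1 e.2
|}.

End SubgroupGraph.

(* Main.v *)
Require Import Defs.
From mathcomp Require Import all_boot.
From mathcomp Require Import boolp classical_sets cardinality.

(** The group G acts on the right cosets of H by right multiplication, and the
    subgroup graph records this action on the generators. Both implications
    come from comparing the actions.

    If K = g^-1 H g, left multiplication by g^-1 sends the coset H u to
    K (g^-1 u). Left multiplication commutes with right multiplication, so it
    is a morphism of graphs ([translation]), and left multiplication by g is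
    its inverse.

    Conversely, exactly one edge with a given label leaves each vertex, so a
    morphism of subgroup graphs commutes with right multiplication by
    generators, hence by their inverses, hence by all of G
    ([morphism_equivariant]). An isomorphism therefore preserves stabilizers.
    The stabilizer of the coset H is H; if this vertex is sent to K g, whose
    stabilizer is g^-1 K g, then H = g^-1 K g. *)

Set Implicit Arguments.
Unset Strict Implicit.
Unset Printing Implicit Defensive.

Local Open Scope classical_set_scope.
Local Open Scope group_scope.

Section Cosets.
Variable G : groupType.
Implicit Types (H A : set G) (g t : G).

Lemma right_coset1 A : right_coset A 1 = A.
Proof.
by rewrite /right_coset -[RHS]image_id; apply: eq_imagel => h _; rewrite mulg1.
Qed.

Lemma eq_right_cosetP H (a b : G) :
  is_subgroup H -> right_coset H a = right_coset H b <-> H (a / b).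
Proof.
move=> sgH; have [/set_mem H1 _] := sgH.
have HM x y : H x -> H y -> H (x * y).
  by move=> /mem_set Hx /mem_set Hy; apply/set_mem/(group_closedM sgH).
have HV x : H x -> H x^-1.
  by move=> /mem_set Hx; apply/set_mem/(group_closedV sgH).
split=> [eqab | Hab].
  have : right_coset H a a by exists 1; rewrite ?mul1g.
  by rewrite eqab => -[h Hh <-]; rewrite mulgK.
apply/seteqP; split=> _ [h Hh <-].
  by exists (h * (a / b)); [exact: HM | rewrite -mulgA mulgVK].
exists (h * (a / b)^-1); first exact/HM/HV.
by rewrite invgM invgK -!mulgA mulVg mulg1.
Qed.

Definition left_coset t A : set G := [set t * a | a in A].

Lemma left_cosetM s t A : left_coset s (left_coset t A) = left_coset (s * t) A.
Proof.
by rewrite /left_coset image_comp; apply: eq_imagel => a _ /=; rewrite mulgA.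
Qed.

Lemma left_coset1 A : left_coset 1 A = A.
Proof.
by rewrite /left_coset -[RHS]image_id; apply: eq_imagel => a _; rewrite mul1g.
Qed.

Lemma left_right_coset t A g :
  left_coset t (right_coset A g) = right_coset (left_coset t A) g.
Proof.
rewrite /left_coset /right_coset !image_comp.
by apply: eq_imagel => a _ /=; rewrite mulgA.
Qed.

(** This is why conjugate subgroups have the same cosets up to a left
    translation: g^-1 H is also a right coset, of the conjugate of H. *)
Lemma left_coset_conj H g :
  left_coset g^-1 H = right_coset [set h ^ g | h in H] g^-1.
Proof.
rewrite /left_coset /right_coset image_comp.
by apply: eq_imagel => h _ /=; rewrite /conjg -!mulgA mulgV mulg1.
Qed.

Lemma conj_imageK H g : [set k ^ g^-1 | k in [set h ^ g | h in H]] = H.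
Proof.
rewrite image_comp -[RHS]image_id; apply: eq_imagel => h _ /=.
by rewrite conjgK.
Qed.

Lemma right_cosets_left_coset H g A :
  right_cosets H A -> right_cosets [set h ^ g | h in H] (left_coset g^-1 A).
Proof.
case=> u _ <-; exists (g^-1 * u) => //.
by rewrite left_right_coset left_coset_conj right_cosetM.
Qed.

End Cosets.

Section Action.
Variables (X : choiceType) (R : set (word X)).
Implicit Types H K : set (presented_group R).

Lemma coset_vertex_eq H (v w : coset_vertex H) : sval v = sval w -> v = w.
Proof. by case: v w => [A HA] [B HB] /= AB; exact: eq_exist. Qed.

Definition coset_act H (v : coset_vertex H) (g : presented_group R) :
    coset_vertex H :=
  exist _ (right_coset (sval v) g) (right_cosetsM g (svalP v)).

Lemma coset_act1 H (v : coset_vertex H) : coset_act v 1 = v.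
Proof. exact/coset_vertex_eq/right_coset1. Qed.

Lemma coset_actM H (v : coset_vertex H) g h :
  coset_act (coset_act v g) h = coset_act v (g * h).
Proof. exact/coset_vertex_eq/right_cosetM. Qed.

(** In the target graph an edge is determined by its origin and label, both of
    which f preserves, so f sends the edge (v, x) to the edge (f v, x). *)
Lemma morphism_coset_step H K
    (f : xgraph_morphism (subgroup_graph H) (subgroup_graph K))
    (v : coset_vertex H) x :
  on_vertices f (coset_step v x) = coset_step (on_vertices f v) x.
Proof.
have := morphism_terminus f (v, x).
have := morphism_origin f (v, x); have := morphism_label f (v, x).
by case: (on_edges f _) => w y /= -> -> ->.
Qed.

(** No edge carries an inverse letter. For x^-1, the value of f at v x^-1 is
    found by following the edge labelled x from v x^-1 to v: its image ends
    at f v, and the step is then undone in the target graph. *)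
Lemma morphism_equivariant H K
    (f : xgraph_morphism (subgroup_graph H) (subgroup_graph K))
    (v : coset_vertex H) (g : presented_group R) :
  on_vertices f (coset_act v g) = coset_act (on_vertices f v) g.
Proof.
rewrite -(word_class_repr g); elim: (repr g) v => [|[x b] w IHw] v.
  by rewrite word_class1 !coset_act1.
rewrite -cat1s word_classM -!coset_actM IHw; congr (coset_act _ _).
case: b; last exact: morphism_coset_step.
have -> : word_class R [:: (x, true)] = (generator R x)^-1.
  by rewrite /generator -word_classV.
set y := generator R x.
rewrite -[LHS]coset_act1 -(mulgV y) -coset_actM; congr (coset_act _ _).
rewrite -[LHS]/(coset_step _ x) -morphism_coset_step.
rewrite -[coset_step _ x]/(coset_act _ y) coset_actM mulVg.
by rewrite coset_act1.
Qed.

End Action.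

Section Translation.
Variables (X : choiceType) (R : set (word X)).
Variables (H K : set (presented_group R)) (g : presented_group R).
Hypothesis conjHK : K = [set h ^ g | h in H].

Lemma translate_subproof (v : coset_vertex H) :
  right_cosets K (left_coset g^-1 (sval v)).
Proof. by rewrite conjHK; apply: right_cosets_left_coset; exact: svalP. Qed.

Definition translate (v : coset_vertex H) : coset_vertex K :=
  exist _ (left_coset g^-1 (sval v)) (translate_subproof v).

Lemma translate_step v x :
  coset_step (translate v) x = translate (coset_step v x).
Proof. exact/coset_vertex_eq/esym/left_right_coset. Qed.

Definition translation :
    xgraph_morphism (subgroup_graph H) (subgroup_graph K) :=
  @XGraphMorphism X (subgroup_graph H) (subgroup_graph K)
    translate (fun e => (translate e.1, e.2))
    (fun=> erefl) (fun=> erefl) (fun e => translate_step e.1 e.2).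

End Translation.

Theorem proposition4p12 (X : finType) (R : set (word X))
    (H K : set (presented_group R)) :
  is_subgroup H -> is_subgroup K -> finite_index H -> finite_index K ->
  (conjugate_subgroups H K <->
  xgraph_isomorphic (subgroup_graph H) (subgroup_graph K)).
Proof.
move=> sgH sgK _ _; split=> [[g HK] | [f [f' [fK _ _ _]]]].
  have KH : H = [set k ^ g^-1 | k in K] by rewrite HK conj_imageK.
  have HKK : cancel (translate HK) (translate KH).
    move=> v; apply: coset_vertex_eq.
    by rewrite /= left_cosetM invgK mulgV left_coset1.
  have KHK : cancel (translate KH) (translate HK).
    move=> v; apply: coset_vertex_eq.
    by rewrite /= left_cosetM invgK mulVg left_coset1.
  exists (translation HK), (translation KH).
  by split=> // -[v x] /=; rewrite ?HKK ?KHK.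
have H_coset : right_cosets H H by exists 1; rewrite ?right_coset1.
pose base : coset_vertex H := exist _ H H_coset.
have [g _ fbase] := svalP (on_vertices f base).
(* The two sides say that y fixes H, respectively its image K g. *)
have stab y : H y <-> K (y ^ g^-1).
  have -> : y ^ g^-1 = (g * y) / g by rewrite /conjg invgK mulgA.
  have -> : H y = H (y / 1) by rewrite invg1 mulg1.
  apply: iff_trans (iff_sym (eq_right_cosetP _ _ sgH)) _.
  apply: iff_trans _ (eq_right_cosetP _ _ sgK).
  rewrite right_coset1 -right_cosetM fbase; split=> [Hy | fy].
    rewrite -[in RHS](_ : coset_act base y = base); last exact: coset_vertex_eq.
    by rewrite morphism_equivariant.
  suff /(congr1 sval) : coset_act base y = base by [].
  apply: (can_inj fK); rewrite morphism_equivariant.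
  exact: coset_vertex_eq.
exists g^-1; apply/seteqP; split=> [k Kk | _ [h Hh <-]]; last exact/stab.
by exists (k ^ g); [apply/stab; rewrite conjgK | rewrite conjgK].
Qed.
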